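(* Let $G$ be a group and $g\neq 1$ an element of $G$ whose image in $G/[g,G]$ does not have infinite order. Then there exists an integer $n\geq 1$ characterized by the following equivalent conditions (that is, for a positive integer $n$ the four conditions are equivalent to one another, and there is exactly one positive integer $n$ satisfying them): (i) The image $\overline{g}$ of $g$ in $G/[g,G]$ has order exactly $n$. (ii) On the set of all relations of the form $\prod_{i=1}^N (h_i^{-1} g h_i)^{\varepsilon_i}=1$ holding in $G$ (with $N\ge 0$, $h_i\in G$, $\varepsilon_i=\pm 1$), the values assumed by $\sum_{i=1}^N \varepsilon_i$ are precisely the multiples of $n$. (iii) On the set of all relations of the form $\prod_{i=1}^M h_i^{-1} g h_i= \prod_{j=1}^{M'} {h'_j}^{-1} g h'_j$ holding in $G$ (with $M,M'\ge 0$, $h_i,h'_j\in G$), the values assumed by $M-M'$ are precisely the multiples of $n$. (iv) For every field $k$ and every element $c\in k-\{0\}$, the element $g-c$ of the group algebra $k\,G$ generates the improper ideal if and only if $c^n\neq 1$.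
   Context: For elements $g,h$ of a group $G$, $[g,h]=g^{-1}h^{-1}gh$, and $[g,G]$ denotes the subgroup of $G$ generated by the elements $[g,h]$ ($h\in G$); it is a normal subgroup of $G$. For a field $k$, $k\,G$ is the group algebra; ''ideal'' means two-sided ideal, and ''generates the improper ideal'' means that the two-sided ideal generated by the element is all of $k\,G$. Empty products equal $1$. *)

(* Defs.v *)
From HB Require Import structures.
From mathcomp Require Import all_boot all_algebra.
From mathcomp Require Import finmap boolp.
From mathcomp Require Import monalg.

Set Implicit Arguments.
Unset Strict Implicit.
Unset Printing Implicit Defensive.

Import GRing.Theory.

Local Open Scope group_scope.

(* Subgroups are [groupClosed] predicates of the library; they are boolean,  *)
(* which is no restriction here since [asbool] turns any proposition into a  *)
(* boolean.                                                                  *)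

HB.mixin Record isNormalClosed (G : groupType) (S : {pred G}) := {
  gpredJr : forall x y, x \in S -> x ^ y \in S
}.

#[short(type="normalClosed")]
HB.structure Definition NormalClosed (G : groupType) :=
  {S of GroupClosed G S & isNormalClosed G S}.

Section Quotient.
Variables (G : groupType) (N : normalClosed G).

Definition eq_coset : rel G := fun x y => x^-1 * y \in N.

Lemma eq_coset_refl : reflexive eq_coset.
Proof. by move=> x; rewrite /eq_coset mulVg gpred1. Qed.

Lemma eq_coset_sym : symmetric eq_coset.
Proof. by move=> x y; rewrite /eq_coset -gpredV invgM invgK. Qed.

Lemma eq_coset_trans : transitive eq_coset.
Proof.
move=> y x z; rewrite /eq_coset => xy yz.
by have := gpredM _ _ xy yz; rewrite -mulgA mulVKg.
Qed.

Canonical eq_coset_equiv :=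
  EquivRel eq_coset eq_coset_refl eq_coset_sym eq_coset_trans.

Local Open Scope quotient_scope.

Definition quotg : Type := {eq_quot eq_coset}.

HB.instance Definition _ := Choice.on quotg.
HB.instance Definition _ := Quotient.on quotg.

Definition to_quotg (x : G) : quotg := \pi_quotg x.

Lemma to_quotgP x y : to_quotg x = to_quotg y <-> x^-1 * y \in N.
Proof. by split=> [/eqquotP|h]; [|apply/eqquotP]. Qed.

Lemma to_quotgK (q : quotg) : to_quotg (repr q) = q.
Proof. exact: reprK. Qed.

Definition oneq : quotg := to_quotg 1.
Definition mulq (p q : quotg) : quotg := to_quotg (repr p * repr q).
Definition invq (p : quotg) : quotg := to_quotg (repr p)^-1.

Lemma mulq_pi x y : mulq (to_quotg x) (to_quotg y) = to_quotg (x * y).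
Proof.
have /to_quotgP hx := to_quotgK (to_quotg x).
have /to_quotgP hy := to_quotgK (to_quotg y).
apply/to_quotgP; set a := repr _ in hx *; set b := repr _ in hy *.
have -> : (a * b)^-1 * (x * y) = (a^-1 * x) ^ b * (b^-1 * y).
  by rewrite conjgE invgM -!mulgA mulVKg.
by rewrite gpredM ?gpredJr.
Qed.

Lemma invq_pi x : invq (to_quotg x) = to_quotg x^-1.
Proof.
have /to_quotgP hx := to_quotgK (to_quotg x).
apply/to_quotgP; rewrite invgK; set a := repr _ in hx *.
have -> : a * x^-1 = ((a^-1 * x)^-1) ^ a^-1.
  by rewrite conjgE invgM !invgK -!mulgA mulgV mulg1.
by rewrite gpredJr ?gpredV.
Qed.

Lemma mulqA : associative mulq.
Proof.
move=> p q r; rewrite -[p]to_quotgK -[q]to_quotgK -[r]to_quotgK.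
by rewrite !mulq_pi mulgA.
Qed.

Lemma mul1q : left_id oneq mulq.
Proof. by move=> p; rewrite -[p]to_quotgK mulq_pi mul1g. Qed.

Lemma mulq1 : right_id oneq mulq.
Proof. by move=> p; rewrite -[p]to_quotgK mulq_pi mulg1. Qed.

Lemma mulVq : left_inverse oneq invq mulq.
Proof. by move=> p; rewrite -[p]to_quotgK invq_pi mulq_pi mulVg. Qed.

Lemma mulqV : right_inverse oneq invq mulq.
Proof. by move=> p; rewrite -[p]to_quotgK invq_pi mulq_pi mulgV. Qed.

HB.instance Definition _ := isGroup.Build quotg mulqA mul1q mulq1 mulVq mulqV.

Lemma to_quotgM : {morph to_quotg : x y / x * y}.
Proof. by move=> x y; rewrite [RHS]mulq_pi. Qed.

HB.instance Definition _ := isGroupMorphism.Build G quotg to_quotg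
  (fun x y => etrans (to_quotgM x y^-1)
                     (congr1 (mulq (to_quotg x)) (esym (invq_pi y)))).

End Quotient.

Section CommutatorSubgroup.
Variables (G : groupType) (g : G).

Definition commg_sub : {pred G} :=
  [pred x | `[< forall S : groupClosed G,
                  (forall h, [~ g, h] \in S) -> x \in S >]].

Lemma commg_subP x :
  reflect (forall S : groupClosed G, (forall h, [~ g, h] \in S) -> x \in S)
          (x \in commg_sub).
Proof. exact: asboolP. Qed.

Lemma commg_subV : invg_closed commg_sub.
Proof.
move=> x /commg_subP hx; apply/commg_subP=> S hS.
by rewrite gpredV; apply: hx.
Qed.

Lemma commg_sub1 : 1 \in commg_sub.
Proof. by apply/commg_subP=> S _; apply: gpred1. Qed.

Lemma commg_subM : mulg_closed commg_sub.
Proof.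
move=> x y /commg_subP hx /commg_subP hy; apply/commg_subP=> S hS.
by rewrite gpredM ?hx ?hy.
Qed.

HB.instance Definition _ := isMulClosed.Build G commg_sub commg_subM.
HB.instance Definition _ := isMul1Closed.Build G commg_sub commg_sub1.
HB.instance Definition _ := isInvClosed.Build G commg_sub commg_subV.

Lemma commg_sub_gen h : [~ g, h] \in commg_sub.
Proof. by apply/commg_subP. Qed.

End CommutatorSubgroup.

Section ConjPred.
Variables (G : groupType) (S : groupClosed G) (y : G).

Definition conj_pred : {pred G} := [pred x | x ^ y \in S].

Lemma conj_predV : invg_closed conj_pred.
Proof. by move=> x; rewrite !inE conjVg gpredV. Qed.

Lemma conj_pred1 : 1 \in conj_pred.
Proof. by rewrite inE conj1g gpred1. Qed.

Lemma conj_predM : mulg_closed conj_pred.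
Proof. by move=> u v; rewrite !inE conjMg; apply: gpredM. Qed.

HB.instance Definition _ := isMulClosed.Build G conj_pred conj_predM.
HB.instance Definition _ := isMul1Closed.Build G conj_pred conj_pred1.
HB.instance Definition _ := isInvClosed.Build G conj_pred conj_predV.

End ConjPred.

Section CommutatorNormal.
Variables (G : groupType) (g : G).

Lemma commg_subJ x y : x \in commg_sub g -> x ^ y \in commg_sub g.
Proof.
move=> /commg_subP hx.
suff: x \in conj_pred (commg_sub g) y by rewrite inE.
apply: hx => h; rewrite inE.
have -> : [~ g, h] ^ y = [~ g, y]^-1 * [~ g, h * y].
  by rewrite /commg !conjgE !invgM !invgK !mulgA !mulgK.
by rewrite gpredM ?gpredV ?commg_sub_gen.
Qed.

HB.instance Definition _ :=
  isNormalClosed.Build G (commg_sub g) commg_subJ.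

End CommutatorNormal.

Definition has_order (G : groupType) (x : G) (n : nat) : Prop :=
  [/\ (0 < n)%N, x ^+ n = 1 & forall m, (0 < m < n)%N -> x ^+ m <> 1].

Definition infinite_order (G : groupType) (x : G) : Prop :=
  forall n, (0 < n)%N -> x ^+ n <> 1.

Definition expgz (G : groupType) (x : G) (z : int) : G :=
  match z with Posz n => x ^+ n | Negz n => x ^- n.+1 end.

(* The library makes {malg R[M]} a ring only for monoids M in which a        *)
(* product equals 1 just when both factors do, which excludes groups; hence  *)
(* the convolution product on the module of finitely supported functions.    *)
Section GroupAlgebra.
Local Open Scope ring_scope.
Local Open Scope fset_scope.
Variables (R : nzRingType) (G : groupType).

Definition group_algebra : Type := {malg R[G]}.

HB.instance Definition _ := GRing.Lmodule.on group_algebra.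

Implicit Types (a b c : group_algebra) (x y : G).

Definition galg (x : G) : group_algebra := << x >>.

Definition gamul a b : group_algebra :=
  \sum_(x <- msupp a) \sum_(y <- msupp b) << a@_x * b@_y *g (x * y)%g >>.

Lemma gamulw (d1 d2 : {fset G}) a b :
  msupp a `<=` d1 -> msupp b `<=` d2 ->
  gamul a b =
    \sum_(x <- d1) \sum_(y <- d2) << a@_x * b@_y *g (x * y)%g >>.
Proof.
move=> le1 le2; rewrite /gamul (big_fset_incl _ le1) /=.
  apply/eq_bigr=> k1 _; apply/big_fset_incl => // k _ /mcoeff_outdom ->.
  by rewrite mulr0 monalgU0.
move=> k _ /mcoeff_outdom ak.
by rewrite big1 => // k' _; rewrite ak mul0r monalgU0.
Qed.

Lemma gamul0g : left_zero 0 gamul.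
Proof. by move=> a; rewrite /gamul msupp0 big_seq_fset0. Qed.

Lemma gamulg0 : right_zero 0 gamul.
Proof.
by move=> a; rewrite /gamul big1 // => x _; rewrite msupp0 big_seq_fset0.
Qed.

Lemma gamulDl : left_distributive gamul +%R.
Proof.
move=> a b c.
rewrite (gamulw (msuppD_le a b) (fsubset_refl (msupp c))).
rewrite (gamulw (fsubsetUl (msupp a) (msupp b)) (fsubset_refl (msupp c))).
rewrite (gamulw (fsubsetUr (msupp a) (msupp b)) (fsubset_refl (msupp c))).
rewrite -big_split /=; apply/eq_bigr=> x _.
rewrite -big_split /=; apply/eq_bigr=> y _.
by rewrite mcoeffD mulrDl monalgUD.
Qed.

Lemma gamulDr : right_distributive gamul +%R.
Proof.
move=> c a b.
rewrite (gamulw (fsubset_refl (msupp c)) (msuppD_le a b)).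
rewrite (gamulw (fsubset_refl (msupp c)) (fsubsetUl (msupp a) (msupp b))).
rewrite (gamulw (fsubset_refl (msupp c)) (fsubsetUr (msupp a) (msupp b))).
rewrite -big_split /=; apply/eq_bigr=> x _.
rewrite -big_split /=; apply/eq_bigr=> y _.
by rewrite mcoeffD mulrDr monalgUD.
Qed.

Lemma gamulUU (r s : R) x y :
  gamul << r *g x >> << s *g y >> = << r * s *g (x * y)%g >>.
Proof.
rewrite (gamulw (msuppU_le (k := x)) (msuppU_le (k := y))).
by rewrite !big_seq_fset1 !mcoeffUU.
Qed.

Lemma gamul_suml (I : Type) (r : seq I) (F : I -> group_algebra) b :
  gamul (\sum_(i <- r) F i) b = \sum_(i <- r) gamul (F i) b.
Proof.
exact: (big_morph (gamul^~ b) (fun a c => gamulDl a c b) (gamul0g b)).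
Qed.

Lemma gamul_sumr (I : Type) (r : seq I) (F : I -> group_algebra) a :
  gamul a (\sum_(i <- r) F i) = \sum_(i <- r) gamul a (F i).
Proof. exact: (big_morph (gamul a) (gamulDr a) (gamulg0 a)). Qed.

Lemma gamulEl a b : gamul a b = \sum_(x <- msupp a) gamul << a@_x *g x >> b.
Proof. by rewrite {1}[a]monalgE gamul_suml. Qed.

Lemma gamulEr a b : gamul a b = \sum_(y <- msupp b) gamul a << b@_y *g y >>.
Proof. by rewrite {1}[b]monalgE gamul_sumr. Qed.

Lemma gamulA : associative gamul.
Proof.
move=> a b c.
rewrite (gamulEl a b) (gamul_suml _ _ c) gamulEl; apply/eq_bigr=> x _.
rewrite (gamulEl b c) (gamul_sumr (msupp b)) (gamulEr _ b) (gamul_suml _ _ c).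
apply/eq_bigr=> y _; rewrite gamulUU (gamulEr _ c) (gamulEr _ c).
rewrite (gamul_sumr (msupp c)); apply/eq_bigr=> z _.
by rewrite !gamulUU mulrA mulgA.
Qed.

Lemma gamul1g : left_id (galg 1%g) gamul.
Proof.
move=> a; rewrite [a]monalgE gamul_sumr; apply/eq_bigr=> x _.
by rewrite gamulUU mul1r mul1g.
Qed.

Lemma gamulg1 : right_id (galg 1%g) gamul.
Proof.
move=> a; rewrite [a]monalgE gamul_suml; apply/eq_bigr=> x _.
by rewrite gamulUU mulr1 mulg1.
Qed.

Lemma galg1_neq0 : galg 1%g != 0.
Proof. by rewrite monalgU_eq0 oner_eq0. Qed.

HB.instance Definition _ := GRing.Zmodule_isNzRing.Build group_algebra
  gamulA gamul1g gamulg1 gamulDl gamulDr galg1_neq0.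

Lemma gascaleU (r s : R) x :
  r *: (<< s *g x >> : group_algebra) = << r * s *g x >>.
Proof. by apply/malgP=> y; rewrite mcoeffZ !mcoeffU mulrnAr. Qed.

Lemma gascale_sumr (I : Type) (l : seq I) (F : I -> group_algebra) (r : R) :
  r *: (\sum_(i <- l) F i) = \sum_(i <- l) r *: F i.
Proof. exact: scaler_sumr. Qed.

Lemma gascaleAl (r : R) a b : r *: (a * b) = (r *: a) * b.
Proof.
have -> : r *: a = \sum_(x <- msupp a) << r * a@_x *g x >>.
  by rewrite {1}[a]monalgE gascale_sumr; apply/eq_bigr=> x _; rewrite gascaleU.
rewrite -[a * b]/(gamul a b) -[RHS]/(gamul _ b) gamul_suml gamulEl.
rewrite gascale_sumr; apply/eq_bigr=> x _; rewrite 2!(gamulEr _ b).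
rewrite gascale_sumr; apply/eq_bigr=> y _.
by rewrite !gamulUU gascaleU mulrA.
Qed.

HB.instance Definition _ :=
  GRing.Lmodule_isLalgebra.Build R group_algebra gascaleAl.

Lemma galgM x y : galg (x * y)%g = galg x * galg y.
Proof. by rewrite [RHS]gamulUU mulr1. Qed.

Lemma galg_1 : galg 1%g = 1.
Proof. by []. Qed.

Lemma galg_scalarE (r : R) : r%:A = << r *g 1%g >> :> group_algebra.
Proof. by rewrite -[1]galg_1 gascaleU mulr1. Qed.

End GroupAlgebra.

Lemma gascaleAr (R : comNzRingType) (G : groupType) (r : R)
  (a b : group_algebra R G) : (r *: (a * b) = a * (r *: b))%R.
Proof.
rewrite -[(a * b)%R]/(gamul a b) -[RHS]/(gamul a _) (gamulEr a b).
rewrite (_ : (r *: b)%R = (\sum_(y <- msupp b) << r * b@_y *g y >>)%R); last first.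
  rewrite {1}[b]monalgE gascale_sumr.
  by apply/eq_bigr=> y _; rewrite gascaleU.
rewrite gamul_sumr gascale_sumr; apply/eq_bigr=> y _; rewrite 2!(gamulEl a).
rewrite gascale_sumr; apply/eq_bigr=> x _.
by rewrite !gamulUU gascaleU mulrCA.
Qed.

HB.instance Definition _ (R : comNzRingType) (G : groupType) :=
  GRing.Lalgebra_isAlgebra.Build R (group_algebra R G) (@gascaleAr R G).

Section TwoSidedIdeals.
Local Open Scope ring_scope.
Variable A : nzRingType.

Definition two_sided_ideal (I : {pred A}) : Prop :=
  zmod_closed I /\ (forall a x, x \in I -> a * x \in I /\ x * a \in I).

Definition ideal_gen (x : A) : {pred A} :=
  [pred y | `[< forall I : {pred A}, two_sided_ideal I -> x \in I -> y \in I >]].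

Definition generates_improper_ideal (x : A) : Prop :=
  forall y, y \in ideal_gen x.

End TwoSidedIdeals.

Section Conditions.
Variables (G : groupType) (g : G).

Definition exponent_sum (z : int) : Prop :=
  exists (N : nat) (h : 'I_N -> G) (eps : 'I_N -> int),
    [/\ forall i, eps i = 1%R \/ eps i = (-1)%R,
        \prod_(i < N) expgz (g ^ h i) (eps i) = 1
      & (\sum_(i < N) eps i)%R = z].

Definition length_difference (z : int) : Prop :=
  exists (M M' : nat) (h : 'I_M -> G) (h' : 'I_M' -> G),
    \prod_(i < M) g ^ h i = \prod_(j < M') g ^ h' j
    /\ (M%:Z - M'%:Z)%R = z.

Definition cond_order (n : nat) : Prop :=
  has_order (to_quotg (commg_sub g) g) n.

Definition cond_exponent_sums (n : nat) : Prop :=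
  forall z : int, exponent_sum z <-> (n%:Z %| z)%Z.

Definition cond_length_differences (n : nat) : Prop :=
  forall z : int, length_difference z <-> (n%:Z %| z)%Z.

Definition cond_group_algebras (n : nat) : Prop :=
  forall (k : fieldType) (c : k), c <> 0%R ->
    generates_improper_ideal (galg k g - c%:A)%R <-> (c ^+ n)%R <> 1%R.

End Conditions.

(* Main.v *)
Require Import Defs.
From mathcomp Require Import all_boot all_algebra.
From HB Require Import structures.
From mathcomp Require Import algC cyclotomic finmap boolp monalg ring.

(** Write t for the image of g in Q = G/[g,G].  Each of the conditions (i),
    (ii), (iii) says that the integers z with t ^ z = 1 are exactly the multiples
    of n, because a relation among conjugates of g and their inverses with
    exponent sum z exists precisely when t ^ z = 1:

    - all conjugates of g have image t in Q, so a relation forces t ^ z = 1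
      ([length_difference_expg]);
    - conversely the generators [g,h] = g^-1 g^h of [g,G] are quotients of two
      conjugates of g, so every element of [g,G] is a product of conjugates of
      g^{+1} and g^{-1} with exponent sum 0 ([commg_sub_conj_frac]).  If
      t ^ m = 1, then g ^ m lies in [g,G], and comparing the two expressions of
      g ^ m gives a relation with exponent sum m.

    The exchange rule u^-1 v = v^u u^-1 moves all the inverses to the right, so
    that every such product is a quotient p q^-1 of two products of conjugates
    of g: this makes relations (ii) and (iii) interchangeable, and is the reason
    why quotients p q^-1 form a graded group ([conj_fracM]).

    For (iv), let I be a two-sided ideal of k G containing g - c.  Modulo I
    every conjugate of g is congruent to c, hence every element of [g,G] is
    congruent to 1; if t ^ m = 1 then I contains c ^ m - 1, which is invertible
    unless c ^ m = 1 ([improper_ideal]).  If on the other hand c ^ m = 1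
    whenever t ^ m = 1, then t ^ m |-> c ^ m, extended by 0 outside the powers
    of t, is a function f on Q with f (t q) = c f (q) and f (1) = 1
    ([exists_quasi_character]).  As t is central in Q, the linear form on k G
    given by f vanishes on x (g - c) y for all x, y in G but not at 1, so that
    g - c generates a proper ideal ([proper_ideal]).  Thus (iv) holds for the
    order n of t.  Finally (iv) determines n, since roots of unity in an
    algebraically closed field of characteristic 0 tell the exponents c ^ n = 1
    and c ^ m = 1 apart ([eq_of_unity_roots]). *)

Set Implicit Arguments.
Unset Strict Implicit.
Unset Printing Implicit Defensive.

Import GRing.Theory.

(** * Orders of elements *)

Section Orders.
Local Open Scope group_scope.
Variables (G : groupType) (x : G).

Lemma expg_sub_eq1 a b : b <= a -> (x ^+ (a - b) = 1) <-> (x ^+ a = x ^+ b).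
Proof.
move=> le_ba; rewrite expgnFr //; split=> [/divg1_eq // | ->]; exact: mulgV.
Qed.

Lemma has_orderP n : 0 < n ->
  has_order x n <-> (forall m, x ^+ m = 1 <-> n %| m).
Proof.
move=> n_gt0; split=> [[_ xn1 n_min] m | xE].
  have xmod : x ^+ m = x ^+ (m %% n).
    by rewrite {1}(divn_eq m n) expgnDr mulnC expgnA xn1 expg1n mul1g.
  rewrite xmod /dvdn; split=> [xm1 | /eqP -> //].
  case: posnP => // m_gt0; case: (n_min (m %% n)) => //.
  by rewrite m_gt0 ltn_mod n_gt0.
split=> // [|m /andP[m_gt0 lt_mn] /xE]; first exact/xE.
by move=> /(dvdn_leq m_gt0); rewrite leqNgt lt_mn.
Qed.

Lemma has_order_uniq m n : has_order x m -> has_order x n -> m = n.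
Proof.
move=> om on; have [m_gt0 xm _] := om; have [n_gt0 xn _] := on.
by apply/eqP; rewrite eqn_dvd; apply/andP; split;
  [apply/(proj1 (has_orderP m_gt0) om) | apply/(proj1 (has_orderP n_gt0) on)].
Qed.

Lemma exists_has_order : ~ infinite_order x -> exists n, has_order x n.
Proof.
move=> fin; have : exists n, (0 < n) && (x ^+ n == 1).
  apply: contrapT => no; apply: fin => n n_gt0 xn; apply: no.
  by exists n; rewrite n_gt0 xn eqxx.
case/ex_minnP=> n /andP[n_gt0 /eqP xn] n_min; exists n; split=> // m.
case/andP=> m_gt0 lt_mn xm; have := n_min m.
by rewrite m_gt0 xm eqxx leqNgt lt_mn => /(_ isT).
Qed.

End Orders.

(** * The subgroup [g,G] and the quotient by it *)

Section Commutators.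
Local Open Scope group_scope.
Variables (G : groupType) (g : G).
Local Notation bar := (to_quotg (commg_sub g)).

(** The subgroup is defined by intersecting boolean subgroups; this form allows
    existential statements to be proved along the generators. *)
Lemma commg_sub_ind (P : G -> Prop) :
    P 1 -> (forall x y, P x -> P y -> P (x * y)) ->
    (forall x, P x -> P x^-1) -> (forall h, P [~ g, h]) ->
  forall x, x \in commg_sub g -> P x.
Proof.
move=> P1 PM PV Pg x /commg_subP Nx.
pose S : {pred G} := [pred y | `[< P y >]].
have SM : mulg_closed S.
  by move=> u v /asboolP Pu /asboolP Pv; apply/asboolP/PM.
have S1 : 1 \in S by apply/asboolP.
have SV : invg_closed S by move=> u /asboolP Pu; apply/asboolP/PV.
pose S' : groupClosed G := HB.pack S (isMulClosed.Build G S SM)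
  (isMul1Closed.Build G S S1) (isInvClosed.Build G S SV).
by apply/asboolP/(Nx S') => h; apply/asboolP.
Qed.

Lemma bar_eq1 x : bar x = 1 <-> x \in commg_sub g.
Proof.
have -> : (1 : quotg (commg_sub g)) = bar 1 by [].
by split=> [/esym /to_quotgP | Nx]; last (apply/esym/to_quotgP);
  rewrite invg1 mul1g.
Qed.

Lemma bar_commute h : commute (bar g) (bar h).
Proof.
by apply/commgP; rewrite -gmulfR; apply/eqP/bar_eq1/commg_sub_gen.
Qed.

Lemma barJ h : bar (g ^ h) = bar g.
Proof. by rewrite gmulfJ; apply/conjg_fixP/commgP/bar_commute. Qed.

Lemma bar_expg_eq1 m : bar g ^+ m = 1 <-> g ^+ m \in commg_sub g.
Proof. by rewrite -gmulfXn; apply: bar_eq1. Qed.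

End Commutators.

(** * Relations among conjugates *)

Section Relations.
Local Open Scope group_scope.
Variables (G : groupType) (g : G).
Local Notation bar := (to_quotg (commg_sub g)).

Definition conj_prod (s : seq G) : G := \prod_(h <- s) g ^ h.

Lemma conj_prod_cat s t : conj_prod (s ++ t) = conj_prod s * conj_prod t.
Proof. exact: big_cat. Qed.

Lemma conj_prodJ s x : conj_prod s ^ x = conj_prod [seq h * x | h <- s].
Proof.
rewrite /conj_prod conjg_prod big_map; apply: eq_bigr => h _.
by rewrite conjgM.
Qed.

Lemma bar_conj_prod s : bar (conj_prod s) = bar g ^+ size s.
Proof.
rewrite /conj_prod; elim: s => [|h s IHs]; first by rewrite big_nil gmulf1.
by rewrite big_cons gmulfM /= barJ IHs expgS.
Qed.

(** The quotient p q^-1 of two products of conjugates of g, with z the difference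
    of their lengths, is written without inverse as x q = p: inversion then just
    exchanges p and q. *)
Definition conj_frac (x : G) (z : int) : Prop :=
  exists s t, x * conj_prod t = conj_prod s
    /\ z = ((size s)%:Z - (size t)%:Z)%R.

Lemma conj_frac1 : conj_frac 1 0%R.
Proof. by exists [::], [::]; rewrite mul1g. Qed.

(** With x = p q^-1 and y = r u^-1, the exchange rule q^-1 r = r^q q^-1 gives
    x y = (p r^q) (u q)^-1. *)
Lemma conj_fracM x y z w :
  conj_frac x z -> conj_frac y w -> conj_frac (x * y) (z + w)%R.
Proof.
move=> [s [t [xt ->]]] [s' [t' [yt ->]]].
exists (s ++ [seq h * conj_prod t | h <- s']), (t' ++ t); split.
  rewrite !conj_prod_cat -conj_prodJ -xt -yt.
  by rewrite -!mulgA; congr (_ * _); rewrite -conjgC !mulgA.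
by rewrite !size_cat size_map !PoszD opprD addrACA [(- _ - _)%R]addrC.
Qed.

Lemma conj_fracV x z : conj_frac x z -> conj_frac x^-1 (- z)%R.
Proof.
by move=> [s [t [xt ->]]]; exists t, s; rewrite opprB -xt mulKg.
Qed.

Lemma conj_fracJ h : conj_frac (g ^ h) 1%R.
Proof.
by exists [:: h], [::]; rewrite /conj_prod big_seq1 big_nil mulg1.
Qed.

Lemma conj_frac_expg m : conj_frac (g ^+ m) m%:Z.
Proof.
elim: m => [|m IHm]; first exact: conj_frac1.
by rewrite expgS intS; apply: conj_fracM => //; rewrite -[g in conj_frac g]conjg1;
  apply: conj_fracJ.
Qed.

(** A generator g^-1 g^h has degree -1 + 1 = 0, and the elements of degree 0 form
    a subgroup. *)
Lemma commg_sub_conj_frac x : x \in commg_sub g -> conj_frac x 0%R.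
Proof.
move: x; apply: commg_sub_ind => [|x y fx fy|x fx|h].
- exact: conj_frac1.
- by have := conj_fracM fx fy.
- by have := conj_fracV fx.
rewrite commgEl -{1}[g]conjg1 -[0%R](addNr 1%R).
by apply: conj_fracM (conj_fracJ h); apply: conj_fracV (conj_fracJ 1).
Qed.

(** For m the absolute value of z, the element g ^ m is a quotient in degree m by
    its very form, and in degree 0 because it lies in [g,G]; dividing, so is 1 in
    degree m.  The sign is adjusted by inversion. *)
Lemma conj_frac1_of_expg z : bar g ^+ `|z|%N = 1 -> conj_frac 1 z.
Proof.
move=> /bar_expg_eq1 /commg_sub_conj_frac /conj_fracV Ng.
have := conj_fracM (conj_frac_expg `|z|) Ng; rewrite mulgV oppr0 addr0.
case: (intP z) => [|n|n] // /conj_fracV.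
by rewrite invg1 abszN.
Qed.

Lemma length_differenceP z : length_difference g z <-> conj_frac 1 z.
Proof.
split=> [[M [M' [h [h' [eq_hh' <-]]]]] | [s [t [eq_st ->]]]].
  exists (map h (index_enum 'I_M)), (map h' (index_enum 'I_M')).
  rewrite mul1g /conj_prod !big_map eq_hh' !size_map.
  by rewrite /index_enum -!enumT !size_enum_ord.
exists (size s), (size t), (tnth (in_tuple s)), (tnth (in_tuple t)).
split=> //; apply: esym; move: eq_st.
by rewrite mul1g /conj_prod (big_tnth _ _ t) (big_tnth _ _ s).
Qed.

(** All conjugates of g have the same image t in the quotient, so a relation
    there reads t ^ M = t ^ M'. *)
Lemma length_difference_expg z :
  length_difference g z -> bar g ^+ `|z|%N = 1.
Proof.
move=> /length_differenceP [s [t [eq_st ->]]].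
have {}eq_st : bar g ^+ size s = bar g ^+ size t.
  by rewrite -!bar_conj_prod -eq_st mul1g.
case: (leqP (size t) (size s)) => [le_ts | /ltnW le_st].
  by rewrite distnEl //; apply/expg_sub_eq1.
by rewrite distnEr //; apply/expg_sub_eq1.
Qed.

Lemma conj_frac_of_exponent_sum z : exponent_sum g z -> conj_frac 1 z.
Proof.
move=> [N [h [eps [epsP <- <-]]]].
apply: (big_ind2 conj_frac) => [|? ? ? ?|i _]; first exact: conj_frac1.
  exact: conj_fracM.
case: (epsP i) => -> /=; first exact: conj_fracJ.
by apply: conj_fracV; exact: conj_fracJ.
Qed.

Lemma exponent_sum_of_seq (s : seq (G * int)) :
    {in s, forall p, p.2 = 1%R \/ p.2 = (-1)%R} ->
    \prod_(p <- s) expgz (g ^ p.1) p.2 = 1 ->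
  exponent_sum g (\sum_(p <- s) p.2)%R.
Proof.
move=> sgn; rewrite 2!(big_tnth _ _ s) => prod1; pose p_ := tnth (in_tuple s).
exists (size s), (fun i => (p_ i).1), (fun i => (p_ i).2); split=> // i.
exact/sgn/mem_tnth.
Qed.

(** The inverse of a product of conjugates lists their inverses in reverse
    order. *)
Lemma exponent_sum_of_conj_frac z : conj_frac 1 z -> exponent_sum g z.
Proof.
move=> [s [t [eq_st ->]]].
pose w := [seq (h, 1%R : int) | h <- s] ++ [seq (h, (-1)%R : int) | h <- rev t].
have -> : ((size s)%:Z - (size t)%:Z = \sum_(p <- w) p.2)%R.
  rewrite big_cat !big_map /= !big_const_seq !count_predT !iter_addr_0.
  by rewrite size_rev mulNrn !natz.
apply: exponent_sum_of_seq => [p|].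
  by rewrite mem_cat => /orP[] /mapP[h _ ->]; [left | right].
rewrite big_cat !big_map /=.
rewrite [X in _ * X](prodgV (rev t) predT (fun h => g ^ h)).
by rewrite revK -/(conj_prod t) -[X in X / _]/(conj_prod s) -eq_st mul1g mulgV.
Qed.

Lemma length_difference_expgE z :
  length_difference g z <-> bar g ^+ `|z|%N = 1.
Proof.
split; first exact: length_difference_expg.
by move=> /conj_frac1_of_expg /length_differenceP.
Qed.

Lemma exponent_sum_expgE z : exponent_sum g z <-> bar g ^+ `|z|%N = 1.
Proof.
split=> [/conj_frac_of_exponent_sum /length_differenceP | ].
  exact: length_difference_expg.
by move=> /conj_frac1_of_expg /exponent_sum_of_conj_frac.
Qed.

(** Conditions (ii) and (iii) are quantified over integers; since the exponents m
    with t ^ m = 1 are stable under negation, natural exponents suffice. *)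
Lemma cond_of_int_period (P : int -> Prop) n :
    (forall z, P z <-> bar g ^+ `|z|%N = 1) -> 0 < n ->
  (forall z, P z <-> (n%:Z %| z)%Z) <-> cond_order g n.
Proof.
move=> PE n_gt0; split=> [Pn | /(has_orderP _ n_gt0) on z].
  by apply/(has_orderP _ n_gt0) => m; rewrite -(PE (Posz m)); apply: Pn.
by rewrite PE on.
Qed.

End Relations.

(** * Ideals of the group algebra *)

Section GroupAlgebraIdeals.
Local Open Scope ring_scope.
Variables (k : fieldType) (G : groupType) (g : G) (c : k).
Local Notation kG := (group_algebra k G).
Local Notation bar := (to_quotg (commg_sub g)).

Section Congruences.
Variables (I : {pred kG}) (idealI : two_sided_ideal I).
Hypothesis I_gc : galg k g - c%:A \in I.

Let I0 : 0 \in I. Proof. by case: idealI => [[]]. Qed.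
Let IB x y : x \in I -> y \in I -> x - y \in I.
Proof. by case: idealI => [[_ HB] _]; apply: HB. Qed.
Let IN x : x \in I -> - x \in I.
Proof. by move=> Ix; rewrite -sub0r IB. Qed.
Let ID x y : x \in I -> y \in I -> x + y \in I.
Proof. by move=> Ix Iy; rewrite -[y]opprK IB ?IN. Qed.
Let IMl a x : x \in I -> a * x \in I.
Proof. by case: idealI => _ HM Ix; case: (HM a x Ix). Qed.
Let IMr a x : x \in I -> x * a \in I.
Proof. by case: idealI => _ HM Ix; case: (HM a x Ix). Qed.

Lemma galgVl (x : G) : galg k x^-1%g * galg k x = 1.
Proof. by rewrite -galgM mulVg galg_1. Qed.

(** The scalar c is central, so conjugating g - c by h gives g^h - c. *)
Lemma ideal_conj h : galg k (g ^ h)%g - c%:A \in I.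
Proof.
have -> : galg k (g ^ h)%g - c%:A
    = galg k h^-1%g * (galg k g - c%:A) * galg k h.
  rewrite mulrBr mulrBl conjgE !galgM mulrA; congr (_ - _).
  by rewrite -scalerAr mulr1 -scalerAl galgVl.
exact/IMr/IMl.
Qed.

(** The elements congruent to 1 modulo an ideal form a subgroup, which contains
    g^-1 g^h because g and g^h are both congruent to c. *)
Lemma ideal_commg_sub x : x \in commg_sub g -> galg k x - 1 \in I.
Proof.
move: x; apply: commg_sub_ind => [|x y Ix Iy|x Ix|h].
- by rewrite galg_1 subrr.
- have -> : galg k (x * y)%g - 1 = (galg k x - 1) * galg k y + (galg k y - 1).
    by rewrite galgM mulrBl mul1r addrA subrK.
  exact/ID/Iy/IMr.
- have -> : galg k x^-1%g - 1 = - (galg k x^-1%g * (galg k x - 1)).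
    by rewrite mulrBr mulr1 galgVl opprB.
  exact/IN/IMl.
have -> : galg k [~ g, h]%g - 1
    = galg k g^-1%g * ((galg k (g ^ h)%g - c%:A) - (galg k g - c%:A)).
  by rewrite opprB addrA subrK mulrBr galgVl commgEl galgM.
exact/IMl/IB/I_gc/ideal_conj.
Qed.

Lemma ideal_expg m : galg k (g ^+ m)%g - (c ^+ m)%:A \in I.
Proof.
elim: m => [|m IHm]; first by rewrite galg_1 scale1r subrr.
have -> : galg k (g ^+ m.+1)%g - (c ^+ m.+1)%:A
    = galg k g * (galg k (g ^+ m)%g - (c ^+ m)%:A)
      + (c ^+ m)%:A * (galg k g - c%:A).
  rewrite expgS galgM !mulrBr -scalerAr mulr1 -!scalerAl !mul1r.
  by rewrite addrA subrK scalerA -exprSr.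
exact/ID/IMl/I_gc/IMl.
Qed.

End Congruences.

(** The power g ^ m lies in [g,G], so it is congruent both to 1 and to c ^ m: the
    ideal contains the nonzero scalar c ^ m - 1. *)
Lemma improper_ideal m :
  (bar g ^+ m = 1)%g -> c ^+ m <> 1 ->
  generates_improper_ideal (galg k g - c%:A).
Proof.
move=> /bar_expg_eq1 Ngm cm1 y; apply/asboolP=> I idealI I_gc.
have [[_ IB] IM] := idealI.
have Icm : (c ^+ m - 1)%:A \in I.
  have -> : (c ^+ m - 1)%:A
      = (galg k (g ^+ m)%g - 1) - (galg k (g ^+ m)%g - (c ^+ m)%:A) :> kG.
    by rewrite opprB [RHS]addrC addrA subrK scalerBl scale1r.
  by apply: IB; [apply: ideal_commg_sub | apply: ideal_expg].
have -> : y = ((c ^+ m - 1)^-1 *: y) * (c ^+ m - 1)%:A.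
  rewrite -scalerAr mulr1 scalerA mulfV ?scale1r //.
  by rewrite subr_eq0; apply/eqP.
by case: (IM ((c ^+ m - 1)^-1 *: y) _ Icm).
Qed.

(** A function on a group transforming under a translation like a character.
    It is supported on the cyclic subgroup generated by t, where it is the
    character sending t to c. *)
Lemma exists_quasi_character (Q : groupType) (t : Q) n :
    (0 < n)%N -> (t ^+ n = 1)%g -> c <> 0 ->
    (forall m, (t ^+ m = 1)%g -> c ^+ m = 1) ->
  exists f : Q -> k, f 1%g = 1 /\ forall q, f (t * q)%g = c * f q.
Proof.
move=> n_gt0 tn1 c_neq0 ct.
have ct_eq a b : (t ^+ a = t ^+ b)%g -> c ^+ a = c ^+ b.
  wlog le_ba : a b / (b <= a)%N => [wlogH | /(expg_sub_eq1 t le_ba) /ct cab].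
    by case: (leqP b a) => [|/ltnW] /wlogH H //; move/esym/H.
  by rewrite -(subnK le_ba) exprD cab mul1r.
pose power q m := q == (t ^+ m)%g.
pose f q := if pselect (exists m, power q m) is left qP
            then c ^+ ex_minn qP else 0.
have fX m : f (t ^+ m)%g = c ^+ m.
  rewrite /f; case: pselect => [qP | []]; last by exists m; rewrite /power.
  by case: ex_minnP => a /eqP/ct_eq.
have f0 q : ~ (exists m, power q m) -> f q = 0.
  by rewrite /f; case: pselect.
exists f; split=> [|q]; first by rewrite -(expg0 t) fX.
have [[m /eqP ->] | qP] := pselect (exists m, power q m).
  by rewrite -expgS !fX exprS.
rewrite !f0 ?mulr0 // => -[m /eqP tq]; apply: qP; exists (n.-1 + m)%N.
(* The inverse of t is the power with exponent n.-1. *)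
by rewrite /power expgnDr -tq mulgA -expgSr prednK // tn1 mul1g.
Qed.

(** A linear form L on k G with L (x g y) = c L (x y) for x, y in G and L 1 = 1
    separates 1 from the ideal.  It comes from a quasi-character of the quotient
    by [g,G]; there g is central, so that being semi-invariant on the left is
    enough for g in the middle of a product. *)
Lemma proper_ideal n :
    (0 < n)%N -> (bar g ^+ n = 1)%g -> c <> 0 ->
    (forall m, (bar g ^+ m = 1)%g -> c ^+ m = 1) ->
  ~ generates_improper_ideal (galg k g - c%:A).
Proof.
move=> n_gt0 gn1 c_neq0 cg /(_ 1) /asboolP.
have [f [f1 fg]] := exists_quasi_character n_gt0 gn1 c_neq0 cg.
pose L : kG -> k := mmap idfun (f \o bar).
have LB a b : L (a - b) = L a - L b by exact: mmapB.
have LD a b : L (a + b) = L a + L b by exact: mmapD.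
have LU r x : L << r *g x >> = r * f (bar x) by exact: mmapU.
have L_sum (T : Type) (s : seq T) (F : T -> kG) :
    L (\sum_(i <- s) F i) = \sum_(i <- s) L (F i).
  exact: raddf_sum.
(* The largest two-sided ideal on which the linear form L vanishes. *)
pose I : {pred kG} := [pred a | `[< forall u v, L (u * a * v) = 0 >]].
have idealI : two_sided_ideal I.
  split; first split.
  - by apply/asboolP=> u v; rewrite mulr0 mul0r /L mmap0.
  - move=> a b /asboolP Ia /asboolP Ib; apply/asboolP=> u v.
    by rewrite mulrBr mulrBl LB Ia Ib subrr.
  by move=> a x /asboolP Ix; split; apply/asboolP=> u v;
    [rewrite mulrA | rewrite mulrA -mulrA]; apply: Ix.
have I_gc : galg k g - c%:A \in I.
  apply/asboolP => u v.
  have -> : galg k g - c%:A = << 1 *g g >> + << - c *g 1%g >>.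
    by rewrite galg_scalarE monalgUN.
  rewrite -mulrA -[u * _]/(gamul u (gamul _ v)) gamulEl L_sum big1 // => x _.
  rewrite (gamulEr _ v) gamul_sumr L_sum big1 // => y _.
  rewrite gamulDl gamulDr LD !gamulUU !LU mul1r mul1g.
  rewrite !gmulfM /= mulgA -(bar_commute g x) -mulgA fg.
  ring.
move=> /(_ I idealI I_gc) /asboolP /(_ 1 1).
rewrite !mulr1 -[1]galg_1 LU mul1r gmulf1 f1.
exact/eqP/oner_neq0.
Qed.

End GroupAlgebraIdeals.

(** * Recovering n from the group algebras *)

Lemma cond_group_algebras_order (G : groupType) (g : G) n :
  cond_order g n -> cond_group_algebras g n.
Proof.
move=> on k c c_neq0; have [n_gt0 gn1 _] := on.
split=> [gen cn1 | cn1]; last exact: improper_ideal gn1 cn1.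
apply: (proper_ideal n_gt0 gn1 c_neq0 _ gen) => m.
move=> /(proj1 (has_orderP _ n_gt0) on) /dvdnP[q ->].
by rewrite mulnC exprM cn1 expr1n.
Qed.

(** A primitive m-th root of unity c satisfies c ^ n = 1 only if m divides n, and
    symmetrically. *)
Lemma eq_of_unity_roots m n : (0 < m)%N -> (0 < n)%N ->
    (forall c : algC, c <> 0 -> c ^+ m <> 1 <-> c ^+ n <> 1)%R ->
  m = n.
Proof.
suff dvd a b : (0 < a)%N ->
    (forall c : algC, c <> 0 -> c ^+ b <> 1 -> c ^+ a <> 1)%R -> a %| b.
  move=> m_gt0 n_gt0 mn; apply/eqP; rewrite eqn_dvd.
  by rewrite !dvd // => c c_neq0; case: (mn c c_neq0).
move=> a_gt0 ab; have [c c_prim] := C_prim_root_exists a_gt0.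
rewrite (prim_order_dvd c_prim); apply/eqP; apply: contrapT => cb.
apply: (ab c _ cb (prim_expr_order c_prim)).
move=> c0; have /eqP := prim_expr_order c_prim.
by rewrite c0 expr0n gtn_eqF // eq_sym oner_eq0.
Qed.

(** In the step from (iv) to (i), the order m of the image of g satisfies (iv) too,
    and only one positive integer can. *)
Theorem theorem4 (G : groupType) (g : G)
    (g_neq1 : g <> 1%g)
    (not_inf : ~ infinite_order (to_quotg (commg_sub g) g)) :
  (forall n : nat, (0 < n)%N ->
     [<-> cond_order g n;
          cond_exponent_sums g n;
          cond_length_differences g n;
          cond_group_algebras g n])
  /\
  (exists! n : nat,
     (0 < n)%N /\
     [/\ cond_order g n,
         cond_exponent_sums g n,
         cond_length_differences g n
       & cond_group_algebras g n]).
Proof.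
have [m om] := exists_has_order not_inf; have [m_gt0 _ _] := om.
have ii n (n_gt0 : 0 < n) : cond_exponent_sums g n <-> cond_order g n.
  exact: cond_of_int_period (exponent_sum_expgE g) n_gt0.
have iii n (n_gt0 : 0 < n) : cond_length_differences g n <-> cond_order g n.
  exact: cond_of_int_period (length_difference_expgE g) n_gt0.
split=> [n n_gt0|].
  tfae.
  - by move/(ii n n_gt0).
  - by move/(ii n n_gt0)/(iii n n_gt0).
  - by move/(iii n n_gt0)/cond_group_algebras_order.
  move=> iv; suff <- : m = n by [].
  apply: eq_of_unity_roots => // c c_neq0.
  by rewrite -(iv _ c c_neq0); apply: iff_sym; apply: cond_group_algebras_order.
exists m; split=> [|n [_ [on _ _ _]]]; last exact: has_order_uniq om on.
split=> //; split=> //; [exact/ii | exact/iii | exact: cond_group_algebras_order].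
Qed.
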